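(* Let $\mathfrak{X}=(X,\{R_i\}_{i=0}^4)$ be a (symmetric) association scheme of class $4$ such that $R_4$ has valency one, $R_0\cup R_4$ is an equivalence relation on $X$, and the induced equivalence classes on the index set $\{0,1,2,3,4\}$ are $\{0,4\},\{1,3\},\{2\}$ (so that $\mathfrak{X}$ is a two-fold cover of its class-two quotient scheme $\overline{\mathfrak{X}}$). Let $P$ be the first eigenmatrix of $\mathfrak{X}$, with the primitive idempotents indexed as described in the context, and let $\theta=\min\{P_{1,2},P_{2,2}\}$. Let $Y_1,\ldots,Y_f$ be $\{0,2,4\}$-cliques of $\mathfrak{X}$ with $|Y_i|=2(1-P_{0,2}/\theta)$ for every $i$, such that $X=\bigcup_{i=1}^f Y_i$ and $Y_i\cap Y_j=\emptyset$ for all distinct $i,j$. Define $$\tilde{R}_i=R_i\ \ (i=0,1,3,4),\qquad \tilde{R}_2=R_2\cap\bigcup_{i=1}^f (Y_i\times Y_i),\qquad \tilde{R}_5=R_2\setminus\tilde{R}_2.$$ Then the pair $\tilde{\mathfrak{X}}=(X,\{\tilde{R}_i\}_{i=0}^5)$ is an association scheme.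
   Context: Association scheme of class $d$: a finite set $X$ with nonempty binary relations $R_0,\ldots,R_d$ on $X$ such that (1) $R_0=\{(x,x)\mid x\in X\}$; (2) $R_0,\ldots,R_d$ partition $X\times X$; (3) each $R_i$ is symmetric; (4) for all $i,j,k$ there is an integer $p_{i,j}^k$ such that $|\{z\in X\mid (x,z)\in R_i,(z,y)\in R_j\}|=p_{i,j}^k$ for all $(x,y)\in R_k$. The adjacency matrix $A_i$ is the $(0,1)$-matrix of $R_i$; the valency of $R_i$ is the constant row sum of $A_i$. The span of $A_0,\ldots,A_d$ over $\mathbb{R}$ (the Bose-Mesner algebra) is commutative and has a basis of primitive idempotents $E_0=\frac{1}{|X|}J,E_1,\ldots,E_d$, where $J$ is the all-ones matrix; the first eigenmatrix $P$ is defined by $A_i=\sum_{j=0}^d P_{j,i}E_j$. Two-fold cover and quotient: when $R_4$ has valency one and $R_0\cup R_4$ is an equivalence relation on $X$, an equivalence relation on the indices $\{0,\ldots,4\}$ is defined by $j\sim k$ if and only if $p_{i,j}^k\neq 0$ for some $i\in\{0,4\}$. If its classes are $\{0,4\},\{1,3\},\{2\}$, then, after ordering $X$ suitably, there are $(0,1)$-matrices $\overline{A}_0,\overline{A}_1,\overline{A}_2$ with $A_0+A_4=\overline{A}_0\otimes J_2$, $A_1+A_3=\overline{A}_1\otimes J_2$, $A_2=\overline{A}_2\otimes J_2$ (where $J_2$ is the $2\times 2$ all-ones matrix), and these are the adjacency matrices of an association scheme $\overline{\mathfrak{X}}$ of class two (a strongly regular graph) on the set $\overline{X}$ of classes of $R_0\cup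 R_4$. Let $\overline{E}_0,\overline{E}_1,\overline{E}_2$ be the primitive idempotents of $\overline{\mathfrak{X}}$ ($\overline{E}_0$ being the normalized all-ones matrix). The primitive idempotents of $\mathfrak{X}$ are indexed so that $E_i=\frac12\overline{E}_i\otimes J_2$ for $i=0,1,2$; $E_3,E_4$ are the remaining two. Clique: for $I\subseteq\{0,1,\ldots,4\}$ containing $0$, a nonempty subset $Y\subseteq X$ is an $I$-clique if $\{i\mid R_i\cap(Y\times Y)\neq\emptyset\}=I$. (The number $2(1-P_{0,2}/\theta)$ is an upper bound for the size of any $\{0,2,4\}$-clique, so the $Y_i$ are $\{0,2,4\}$-cliques attaining this bound.)
   Formalization: The formal theorem additionally assumes that R̃_5 = R_2 \ R̃_2 is nonempty; without this the claim fails, e.g. for the binary Hamming scheme H(4,2) with the even and odd halves as cliques, where R̃_5 is empty although all relations must be nonempty. *)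

(* Defs.v *)
From mathcomp Require Import all_boot all_order all_algebra.
From mathcomp Require Import reals mxtens.
Set Implicit Arguments.
Unset Strict Implicit.
Unset Printing Implicit Defensive.
Import GRing.Theory Num.Theory.
Local Open Scope ring_scope.

(** * Association schemes *)

Section Schemes.
Variables (X : finType) (d : nat).
Implicit Type R : 'I_d.+1 -> {set X * X}.

Definition paths2 R (i j : 'I_d.+1) (x y : X) : {set X} :=
  [set z | ((x, z) \in R i) && ((z, y) \in R j)].

Definition association_scheme R : Prop :=
  [/\ forall i, R i != set0,
      R ord0 = [set xy | xy.1 == xy.2],
      (\bigcup_i R i = setT) /\
        (forall i j, i != j -> [disjoint R i & R j]),
      forall i x y, (x, y) \in R i -> (y, x) \in R i &
      forall i j k, exists p : nat,
        forall x y, (x, y) \in R k -> #|paths2 R i j x y| = p].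

(* p_{i,j}^k, computed at some element of R_k; in an association scheme such
   an element exists and its choice is irrelevant. *)
Definition intersection_number R (i j k : 'I_d.+1) : nat :=
  if [pick xy in R k] is Some xy then #|paths2 R i j xy.1 xy.2| else 0%N.

Definition is_clique R (I : {set 'I_d.+1}) (Y : {set X}) : Prop :=
  [/\ ord0 \in I, Y != set0 & [set i | R i :&: setX Y Y != set0] = I].

End Schemes.

(** * Adjacency matrices, Bose-Mesner algebra, first eigenmatrix *)

Section Matrices.
Variables (F : realType) (X : finType) (n : nat).

(* The point set is ordered by s, which is meant to be a bijection. *)
Variable s : 'I_n -> X.

Definition adjmx (r : {set X * X}) : 'M[F]_n :=
  \matrix_(a, b) ((s a, s b) \in r)%:R.

Definition has_valency (r : {set X * X}) (k : nat) : Prop :=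
  forall a, \sum_b adjmx r a b = k%:R.

Variable d : nat.
Implicit Type R : 'I_d.+1 -> {set X * X}.

Definition bose_mesner R : {vspace 'M[F]_n} :=
  <<[seq adjmx (R i) | i : 'I_d.+1]>>%VS.

Definition primitive_idempotent R (e : 'M[F]_n) : Prop :=
  [/\ e \in bose_mesner R, e != 0, e *m e = e &
      forall f, f \in bose_mesner R -> f *m f = f ->
        f *m e = f -> f = 0 \/ f = e].

Definition primitive_idempotents R (E : 'I_d.+1 -> 'M[F]_n) : Prop :=
  [/\ E ord0 = n%:R^-1 *: const_mx 1,
      forall j, primitive_idempotent R (E j) &
      basis_of (bose_mesner R) [seq E j | j : 'I_d.+1]].

Definition first_eigenmatrix R (E : 'I_d.+1 -> 'M[F]_n) (P : 'M[F]_d.+1) :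
    Prop :=
  forall i, adjmx (R i) = \sum_j P j i *: E j.

End Matrices.

(** * Two-fold covers and their class-two quotients *)

Section Covers.
Variable X : finType.
Implicit Type R : 'I_5 -> {set X * X}.

Definition fibre_rel R : rel X :=
  fun x y => (x, y) \in R (inord 0) :|: R (inord 4).

Definition index_rel R : rel 'I_5 :=
  fun j k => [exists i in [set inord 0; inord 4],
                intersection_number R i j k != 0%N].

Definition index_block (i : 'I_3) : {set 'I_5} :=
  match val i with
  | 0 => [set inord 0; inord 4]
  | 1 => [set inord 1; inord 3]
  | _ => [set inord 2]
  end.

Definition two_fold_cover R : Prop :=
  equivalence_rel (fibre_rel R) /\
  equivalence_partition (index_rel R) [set: 'I_5] =
    [set index_block i | i : 'I_3].

Definition fibres R : {set {set X}} :=
  equivalence_partition (fibre_rel R) [set: X].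

Definition quotient R : finType := {C : {set X} | C \in fibres R}.

Definition quotient_rel R (i : 'I_3) : {set quotient R * quotient R} :=
  [set CD : quotient R * quotient R | [exists x in val CD.1, [exists y in val CD.2,
     [exists k in index_block i, (x, y) \in R k]]]].

(* Orderings of X and of the set of fibres such that the positions 2a and
   2a+1 of X are occupied by the two elements of the a-th fibre; these are the
   orderings in which lifted matrices take the form M (x) J_2. *)
Definition cover_ordering R m (t : 'I_m -> quotient R) (s : 'I_(m * 2) -> X) :
    Prop :=
  [/\ bijective t, bijective s &
      forall a, s a \in val (t (mxtens_unindex a).1)].

Definition J2 (F : realType) : 'M[F]_2 := const_mx 1.

Lemma index_block_inj (i i' : 'I_3) k :
  k \in index_block i -> k \in index_block i' -> i = i'.
Proof.
move=> ki ki'; apply: val_inj; move: ki ki'.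
case: i => [[|[|[|//]]] ?]; case: i' => [[|[|[|//]]] ?] //=;
  rewrite /index_block /= !inE -!val_eqE /= !inordK //;
  by case: k => [[|[|[|[|[|//]]]]] ?].
Qed.

Lemma intersection_number_neq0 R i j k x y z :
  association_scheme R -> (x, z) \in R i -> (z, y) \in R j ->
  (x, y) \in R k -> intersection_number R i j k != 0%N.
Proof.
case=> _ _ _ _ Rint xz zy xy; have [p Hp] := Rint i j k.
rewrite /intersection_number; case: pickP => [[u v] uv | /(_ (x, y))];
  last by rewrite xy.
rewrite (Hp _ _ uv) -(Hp _ _ xy) -lt0n; apply/card_gt0P; exists z.
by rewrite inE xz zy.
Qed.

Lemma index_rel_block R (i : 'I_3) k j :
  association_scheme R -> two_fold_cover R ->
  index_rel R k j -> k \in index_block i -> j \in index_block i.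
Proof.
move=> RA [_ Rpart] kj ki.
have kk : index_rel R k k.
  have [R0 Rdiag _ _ _] := RA; have /set0Pn[[x y] xy] := R0 k.
  apply/existsP; exists (inord 0); rewrite !inE eqxx /=.
  apply: (intersection_number_neq0 (x := x) (y := y) (z := x)) => //.
  have -> : inord 0 = ord0 :> 'I_5 by apply: val_inj; rewrite /= inordK.
  by rewrite Rdiag inE.
have : [set y in [set: 'I_5] | index_rel R k y] \in
    equivalence_partition (index_rel R) [set: 'I_5].
  by apply/imsetP; exists k; rewrite ?inE.
rewrite Rpart => /imsetP[i' _ E].
have ki' : k \in index_block i' by rewrite -E !inE.
by rewrite (index_block_inj ki ki') -E !inE.
Qed.

Lemma block_fibrel R (i : 'I_3) k x x' y :
  association_scheme R -> two_fold_cover R -> fibre_rel R x' x ->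
  k \in index_block i -> (x, y) \in R k ->
  exists2 j, j \in index_block i & (x', y) \in R j.
Proof.
move=> RA R2 xx' ki xy; have [_ _ [Rcov _] _ _] := RA.
have : (x', y) \in \bigcup_i R i by rewrite Rcov inE.
case/bigcupP=> j _ x'y; exists j => //.
apply: (index_rel_block RA R2 _ ki); apply/existsP.
by move: xx'; rewrite /fibre_rel in_setU => /orP[] xx';
  [exists (inord 0) | exists (inord 4)]; rewrite !inE eqxx ?orbT /=;
  apply: (intersection_number_neq0 RA xx' xy).
Qed.

Lemma fibre_mem R (C : quotient R) x y :
  two_fold_cover R -> x \in val C -> y \in val C -> fibre_rel R x y.
Proof.
case=> Re _; case: C => C /=; rewrite /fibres => /imsetP[z _ ->].
rewrite !inE => zx zy.
have [zz Rzx] := Re z x y.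
by rewrite -(Rzx zx).
Qed.

Lemma quotient_adjmx (F : realType) R m (t : 'I_m -> quotient R)
    (s : 'I_(m * 2) -> X) :
  association_scheme R -> two_fold_cover R -> cover_ordering t s ->
  forall i : 'I_3,
    \sum_(k in index_block i) adjmx F s (R k) =
      adjmx F t (quotient_rel R i) *t J2 F.
Proof.
move=> RA R2 [_ _ st] i; apply/matrixP => a b.
have [_ _ [_ Rdis] Rsym _] := RA.
rewrite summxE [RHS]mxE [X in _ * X]mxE mulr1 [RHS]mxE inE /=.
set B := [exists x in _, _].
have EB : B = [exists k in index_block i, (s a, s b) \in R k].
  apply/idP/idP => [|H]; last first.
    by apply/existsP; exists (s a); rewrite st /=; apply/existsP;
       exists (s b); rewrite st.
  case/existsP => x /andP[xa /existsP[y /andP[yb /existsP[k /andP[ki xy]]]]].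
  have [j ji ay] := block_fibrel RA R2 (fibre_mem R2 (st a) xa) ki xy.
  have [l li ba] := block_fibrel RA R2 (fibre_mem R2 (st b) yb) ji
    (Rsym _ _ _ ay).
  by apply/existsP; exists l; rewrite li; apply: Rsym.
rewrite EB; case: existsP => [[k /andP[ki ab]] | no].
  rewrite (bigD1 k) //= mxE ab big1 ?addr0 // => j /andP[ji jk].
  rewrite mxE; case: (boolP (_ \in R j)) => // abj.
  by have := Rdis _ _ jk; move/pred0P/(_ (s a, s b)) => /=; rewrite abj ab.
rewrite big1 // => j ji; rewrite mxE; case: (boolP (_ \in R j)) => // abj.
by case: no; exists j; rewrite ji.
Qed.

(* The relation with index 5 may be empty, e.g. when R_2 together with R_0 and
   R_4 is an equivalence relation, as in the binary Hamming scheme H(4,2). *)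
Definition refined_rel R f (Y : 'I_f -> {set X}) (i : 'I_6) : {set X * X} :=
  let U := \bigcup_j setX (Y j) (Y j) in
  match val i with
  | 2 => R (inord 2) :&: U
  | 5 => R (inord 2) :\: (R (inord 2) :&: U)
  | k => R (inord k)
  end.

End Covers.

(* Main.v *)
Require Import Defs.
From mathcomp Require Import all_boot all_order all_algebra.
From mathcomp Require Import reals mxtens ring lra.
Set Implicit Arguments.
Unset Strict Implicit.
Unset Printing Implicit Defensive.
Import Order.TTheory GRing.Theory Num.Theory.
Local Open Scope ring_scope.

(** Write A_i for the adjacency matrix of R_i and B for the block matrix of the
    union U of the squares Y_j x Y_j, so that B is the sum of A_0, A_4 and the
    adjacency matrix of the refined second relation.  For symmetric relations
    that partition X x X and include the diagonal, the last axiom of an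
    association scheme says that the span of the adjacency matrices is closed
    under products: a matrix lies in this span exactly when its entries are
    constant on each relation ([bose_mesnerP]), and the entries of a product of
    adjacency matrices count paths of length two.  The span for the refined
    relations is W = <A_0, ..., A_4> + <B> ([refined_bose_mesner]).  All
    elements of W are symmetric, so W is closed under products as soon as it
    contains every A_i B and B B ([refined_association_scheme]).

    These products are controlled by the cliques.  Let y be their common size,
    and let j in {1, 2} be such that theta = P_{j,2}.  For a clique Y with
    characteristic vector chi, the number chi^T E_j chi is at least 0, being the
    squared norm of E_j chi.  On the other hand, expand E_j in the A_i.  Only A_0, A_2, A_4 contribute on
    a {0,2,4}-clique, and the coefficients on these three are determined by
    A_4 E_j = E_j and A_2 E_j = theta E_j up to a positive factor.  If a is the
    number of pairs of Y in R_4, the assumption on |Y| turns this into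
    (y - 2) chi^T E_j chi = q_0 y (a - y) with q_0 > 0 and y > 2.  Since
    a <= y, both sides vanish: Y is closed under the antipodal map
    ([clique_antipode]) and E_j chi = 0 ([clique_idempotent]).

    Collecting the cliques, A_4 B = B and E_j B = 0.  The description of
    E_0, E_1, E_2 as lifts from the quotient gives A_0 + A_4 =
    2 (E_0 + E_1 + E_2) and A_2 = P_{0,2} E_0 + P_{1,2} E_1 + P_{2,2} E_2.
    With E_j B = 0, these make A_2 B a combination of the all-ones matrix J and
    B.  Next, A_4 A_1 = A_3 because the antipodal map exchanges R_1 and R_3
    ([antipode_swap]), so A_1 B = A_1 A_4 B = A_3 B, and this is half of
    (J - A_0 - A_4 - A_2) B.  Finally B B = y B because the cliques partition
    X. *)

(** * Spans and small index types *)

Lemma span_imageP (K : fieldType) (vT : vectType K) (I : finType)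
    (f : I -> vT) (v : vT) :
  v \in <<[seq f i | i : I]>>%VS <-> exists c : I -> K, v = \sum_i c i *: f i.
Proof.
rewrite span_def big_map big_enum /=; split => [/memv_sumP[w wf ->] | [c ->]].
  have /fin_all_exists[c wc] i : exists c, w i = c *: f i.
    by apply/vlineP/wf.
  by exists c; apply: eq_bigr => i _.
by apply: memv_sumr => i _; apply/memvZ/memv_line.
Qed.

Lemma inord0 : inord 0 = ord0 :> 'I_5.
Proof. by apply: val_inj; rewrite /= inordK. Qed.

Lemma ord5P (Q : 'I_5 -> Prop) : Q (inord 0) -> Q (inord 1) -> Q (inord 2) ->
  Q (inord 3) -> Q (inord 4) -> forall i, Q i.
Proof.
move=> Q0 Q1 Q2 Q3 Q4 i; rewrite -(inord_val i).
by case: i => [[|[|[|[|[|//]]]]]].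
Qed.

Lemma sum_ord5 (V : nmodType) (f : 'I_5 -> V) :
  \sum_i f i =
    f (inord 0) + f (inord 1) + f (inord 2) + f (inord 3) + f (inord 4).
Proof.
rewrite !big_ord_recl big_ord0 addr0 !addrA.
by do ![congr (_ + _)]; congr f; apply: val_inj; rewrite /= inordK.
Qed.

(** * The Bose-Mesner algebra *)

Section BoseMesner.
Variables (F : realType) (X : finType) (n : nat) (s : 'I_n -> X).
Hypothesis s_bij : bijective s.
Implicit Types (r : {set X * X}) (e : 'M[F]_n).

Lemma adjmx_mulE r r' a b :
  (adjmx F s r *m adjmx F s r') a b =
    #|[set z | ((s a, z) \in r) && ((z, s b) \in r')]|%:R.
Proof.
rewrite mxE -sum1_card natr_sum (reindex s) /=; last exact: onW_bij.
rewrite [RHS]big_mkcond /=; apply: eq_bigr => c _.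
by rewrite !mxE !inE; do 2!case: (_ \in _); rewrite /= ?(mul0r, mulr0, mulr1).
Qed.

Variables (d : nat) (R : 'I_d.+1 -> {set X * X}).

Lemma combination_entry (q : 'I_d.+1 -> F) a b k :
  (forall i j, i != j -> [disjoint R i & R j]) -> (s a, s b) \in R k ->
  (\sum_i q i *: adjmx F s (R i)) a b = q k.
Proof.
move=> Rdis abk; rewrite summxE (bigD1 k) //= !mxE abk mulr1 big1 ?addr0 //.
by move=> i ik; rewrite !mxE (disjointFl (Rdis _ _ ik) abk) mulr0.
Qed.

(** The relations partition the set of pairs, so the coefficients of a
    combination of adjacency matrices are read off its entries. *)
Lemma bose_mesnerP e :
  \bigcup_i R i = setT -> (forall i j, i != j -> [disjoint R i & R j]) ->
  e \in bose_mesner F s R <->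
  exists q, forall a b k, (s a, s b) \in R k -> e a b = q k.
Proof.
move=> Rcov Rdis; rewrite span_imageP; split=> [[q ->] | [q eq]]; exists q.
  by move=> a b k; apply: combination_entry.
apply/matrixP => a b; have : (s a, s b) \in \bigcup_i R i by rewrite Rcov inE.
by case/bigcupP => k _ abk; rewrite (eq _ _ _ abk) (combination_entry _ Rdis abk).
Qed.

(** A product of adjacency matrices has the numbers of two-step paths as its
    entries; membership in the span makes these constant on R_k. *)
Lemma intersection_numbers_of_mul i j k :
  (forall i j, i != j -> [disjoint R i & R j]) ->
  adjmx F s (R i) *m adjmx F s (R j) \in bose_mesner F s R ->
  exists p : nat, forall x y, (x, y) \in R k -> #|paths2 R i j x y| = p.
Proof.
move=> Rdis /span_imageP[q Eq]; exists (intersection_number R i j k) => x y xy.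
have H u v : (u, v) \in R k -> #|paths2 R i j u v|%:R = q k.
  have [s' _ s'K] := s_bij.
  rewrite -(s'K u) -(s'K v) => uv.
  by rewrite -(combination_entry q Rdis uv) -Eq adjmx_mulE.
rewrite /intersection_number; case: pickP => [[u v] /= uv | /(_ (x, y))]; last first.
  by rewrite xy.
by apply/eqP; rewrite -(eqr_nat F) !H.
Qed.

Hypothesis RA : association_scheme R.

Lemma bose_mesner_adjmx k : adjmx F s (R k) \in bose_mesner F s R.
Proof. by apply/memv_span/map_f/mem_enum. Qed.

Lemma bose_mesner_mul e e' : e \in bose_mesner F s R ->
  e' \in bose_mesner F s R -> e *m e' \in bose_mesner F s R.
Proof.
have [_ _ [Rcov Rdis] _ Rint] := RA.
move=> /span_imageP[q ->] /span_imageP[q' ->].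
rewrite mulmx_suml memv_suml // => i _; rewrite mulmx_sumr memv_suml // => j _.
rewrite -scalemxAl -scalemxAr; do 2!apply: memvZ.
apply/bose_mesnerP => //.
exists (fun k => (intersection_number R i j k)%:R) => a b k abk.
rewrite adjmx_mulE; congr (_%:R).
have [p Hp] := Rint i j k; rewrite /intersection_number.
case: pickP => [[u v] uv | /(_ (s a, s b))]; last by rewrite abk.
by rewrite (Hp _ _ uv) -(Hp _ _ abk).
Qed.

Lemma bose_mesner_sym e : e \in bose_mesner F s R -> e^T = e.
Proof.
have [_ _ [Rcov Rdis] Rsym _] := RA => /bose_mesnerP[] // q eq.
apply/matrixP => a b; rewrite mxE.
have : (s a, s b) \in \bigcup_i R i by rewrite Rcov inE.
by case/bigcupP => k _ abk; rewrite (eq a b k) // (eq b a k) // Rsym.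
Qed.

Lemma bose_mesner_comm e e' : e \in bose_mesner F s R ->
  e' \in bose_mesner F s R -> e *m e' = e' *m e.
Proof.
move=> eR e'R; rewrite -[LHS]bose_mesner_sym ?bose_mesner_mul //.
by rewrite trmx_mul !bose_mesner_sym.
Qed.

Lemma adjmx0 : adjmx F s (R ord0) = 1%:M.
Proof.
have [_ Rdiag _ _ _] := RA.
by apply/matrixP => a b; rewrite !mxE Rdiag inE /= (bij_eq s_bij).
Qed.

Lemma sum_adjmx : \sum_i adjmx F s (R i) = const_mx 1.
Proof.
have [_ _ [Rcov Rdis] _ _] := RA; apply/matrixP => a b.
have : (s a, s b) \in \bigcup_i R i by rewrite Rcov inE.
case/bigcupP => i _ abi.
rewrite (eq_bigr _ (fun i _ => esym (scale1r (adjmx F s (R i))))).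
by rewrite (combination_entry (fun=> 1) Rdis abi) mxE.
Qed.

Lemma bose_mesner_const c : const_mx c \in bose_mesner F s R.
Proof.
have [_ _ [Rcov Rdis] _ _] := RA.
by apply/bose_mesnerP => //; exists (fun=> c) => a b k; rewrite mxE.
Qed.

(** The product of two primitive idempotents is an idempotent below both, hence
    0 or equal to each of them; two distinct members of a basis differ. *)
Lemma primitive_idempotents_orthogonal (E : 'I_d.+1 -> 'M[F]_n) i j :
  primitive_idempotents s R E -> E i *m E j = if i == j then E i else 0.
Proof.
case=> _ Eprim Ebasis; have [Ei _ Eii Emin] := Eprim i.
have [Ej _ Ejj Ejmin] := Eprim j.
case: eqP => [<- //|/eqP ij].
have fR : E i *m E j \in bose_mesner F s R by apply: bose_mesner_mul.
have C := bose_mesner_comm Ei Ej.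
have fE : (E i *m E j) *m E j = E i *m E j by rewrite -mulmxA Ejj.
have fE' : (E i *m E j) *m E i = E i *m E j by rewrite C -mulmxA Eii.
have ff : (E i *m E j) *m (E i *m E j) = E i *m E j by rewrite mulmxA fE' fE.
have [//|Hi] := Emin _ fR ff fE'; have [//|Hj] := Ejmin _ fR ff fE.
have /free_uniq := basis_free Ebasis.
move/injectiveP => /(_ i j (etrans (esym Hi) Hj)) eij.
by rewrite eij eqxx in ij.
Qed.

End BoseMesner.

(** * The antipodal map *)

Section Antipodes.
Variables (F : realType) (X : finType) (n : nat) (s : 'I_n -> X).
Hypothesis s_bij : bijective s.
Implicit Types (r : {set X * X}).

Lemma valency1_inj r x y z : has_valency F s r 1 ->
  (x, y) \in r -> (x, z) \in r -> y = z.
Proof.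
have [s' s'K ss'] := s_bij; rewrite -(ss' x) -(ss' y) -(ss' z).
move: (s' x) (s' y) (s' z) => a b c r1 ab ac.
apply/eqP/negPn/negP => bc.
have cb : c != b by apply: contraNneq bc => ->.
have := r1 a; rewrite (bigD1 b) //= (bigD1 c) //= !mxE ab ac /=.
have : 0 <= \sum_(i | (i != b) && (i != c)) adjmx F s r a i.
  by apply: sumr_ge0 => i _; rewrite mxE ler0n.
by lra.
Qed.

(** A relation of valency one acts as a permutation of the rows. *)
Lemma mul_adjmx_valency1 p r (M N : 'M[F]_(n, p)) : has_valency F s r 1 ->
  (forall a c b, (s a, s c) \in r -> M c b = N a b) -> adjmx F s r *m M = N.
Proof.
move=> r_valency MN.
have r1 a : \sum_b adjmx F s r a b = 1 by apply: r_valency.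
apply/matrixP => a b; rewrite mxE -[RHS]mul1r -(r1 a) mulr_suml.
apply: eq_bigr => c _; case: (boolP ((s a, s c) \in r)) => [ac | nac].
  by rewrite (MN a c).
by rewrite mxE (negPf nac) !mul0r.
Qed.

Variable R : 'I_5 -> {set X * X}.
Hypothesis RA : association_scheme R.
Hypothesis R4 : has_valency F s (R (inord 4)) 1.

Lemma intersection_number_ex i j k x y : (x, y) \in R k ->
  intersection_number R i j k != 0%N ->
  exists2 z, (x, z) \in R i & (z, y) \in R j.
Proof.
have [_ _ _ _ Rint] := RA; have [p Hp] := Rint i j k => xy.
rewrite /intersection_number; case: pickP => // -[u v] uv.
rewrite (Hp _ _ uv) -(Hp _ _ xy) -lt0n => /card_gt0P[z].
by rewrite inE => /andP[]; exists z.
Qed.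

Lemma index_rel_refl i : index_rel R i i.
Proof.
have [R0 Rdiag _ _ _] := RA; have /set0Pn[[x y] xy] := R0 i.
apply/existsP; exists (inord 0); rewrite !inE eqxx /=.
apply: (intersection_number_neq0 (x := x) (y := y) (z := x)) => //.
by rewrite inord0 Rdiag inE.
Qed.

(** For distinct i and k, the relation i ~ k cannot come from the diagonal, so
    it is witnessed by R_4. *)
Lemma index_rel_neq i k : index_rel R i k -> i != k ->
  intersection_number R (inord 4) i k != 0%N.
Proof.
have [R0 Rdiag [_ Rdis] _ _] := RA; have /set0Pn[[x y] xy] := R0 k.
case/existsP => j /andP[]; rewrite !inE => /orP[] /eqP -> // pn0 ik.
have [z xz zy] := intersection_number_ex xy pn0.
move: xz; rewrite inord0 Rdiag inE /= => /eqP xz; move: zy; rewrite -xz => zy.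
by rewrite (disjointFr (Rdis _ _ ik) zy) in xy.
Qed.

Hypothesis R2 : two_fold_cover R.

(** Since 1 and 3 form one index class, p_{4,1}^3 and p_{4,3}^1 are nonzero; as
    antipodes are unique, passing to the antipode therefore exchanges R_1 and
    R_3. *)
Lemma antipode_swap i j x y z :
  [set i; j] = [set inord 1; inord 3] -> i != j ->
  (x, z) \in R (inord 4) -> (z, y) \in R i -> (x, y) \in R j.
Proof.
move=> ijE ij xz zy; have [_ _ _ Rsym _] := RA.
suff pn0 : intersection_number R (inord 4) j i != 0%N.
  have [w zw wy] := intersection_number_ex zy pn0.
  by rewrite (valency1_inj R4 (Rsym _ _ _ xz) zw).
have : [set i; j] \in equivalence_partition (index_rel R) [set: 'I_5].
  rewrite R2.2; apply/imsetP; exists (inord 1); rewrite ?inE //.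
  by rewrite ijE /index_block /= inordK.
case/imsetP => k _ ijk.
have ki : index_rel R k i by have := set21 i j; rewrite ijk !inE.
have kj : index_rel R k j by have := set22 i j; rewrite ijk !inE.
(* The class of k contains k, so k is i or j; it directly gives one of the two
   numbers, and reversing a path gives the other. *)
have : k \in [set i; j] by rewrite ijk !inE index_rel_refl.
rewrite !inE => /orP[] /eqP kE; last first.
  by apply: index_rel_neq; rewrite -?kE // kE eq_sym.
have /set0Pn[[u v] uv] : R j != set0 by have [] := RA.
have nij : intersection_number R (inord 4) i j != 0%N.
  by apply: index_rel_neq; rewrite // -kE.
have [w uw wv] := intersection_number_ex uv nij.
exact: intersection_number_neq0 RA (Rsym _ _ _ uw) uv wv.
Qed.

End Antipodes.

(** * Cliques attaining the bound *)

Section Delsarte.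
Variables (F : realType) (X : finType) (n : nat) (s : 'I_n -> X).
Variable R : 'I_5 -> {set X * X}.
Variables (e : 'M[F]_n) (k theta : F) (Y : {set X}).
Hypothesis s_bij : bijective s.
Hypothesis RA : association_scheme R.
Hypothesis R4 : has_valency F s (R (inord 4)) 1.
Local Notation A i := (adjmx F s (R (inord i))).
Hypothesis eR : e \in bose_mesner F s R.
Hypothesis e0 : e != 0.
Hypothesis ee : e *m e = e.
Hypothesis A4e : A 4 *m e = e.
Hypothesis A2e : A 2 *m e = theta *: e.
Hypothesis k0 : 0 < k.
Hypothesis A2k : forall a, \sum_b A 2 a b = k.
Hypothesis YC : is_clique R [set inord 0; inord 2; inord 4] Y.
Hypothesis Ysize : #|Y|%:R = 2 * (1 - k / theta).

Let A4_row a : \sum_b A 4 a b = 1.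
Proof. exact: R4. Qed.

Let e_sym a b : e a b = e b a.
Proof. by rewrite -[in LHS](bose_mesner_sym RA eR) mxE. Qed.

Lemma clique_rel x y i : x \in Y -> y \in Y -> (x, y) \in R i ->
  i \in [set inord 0; inord 2; inord 4].
Proof.
move=> xY yY xy; have [_ _ <-] := YC; rewrite inE; apply/set0Pn.
by exists (x, y); rewrite !inE xy xY.
Qed.

Lemma clique_pair i : i \in [set inord 0; inord 2; inord 4] ->
  exists2 xy, xy \in R i & (xy.1 \in Y) && (xy.2 \in Y).
Proof.
have [_ _ <-] := YC; rewrite inE => /set0Pn[xy]; rewrite !inE => /andP[].
by exists xy.
Qed.

(** A pair in R_2 and a pair in R_4 cannot span the same two points.  This
    strictness excludes the degenerate case theta = 0, where the size condition
    would read |Y| = 2. *)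
Lemma clique_size_gt2 : 2 < #|Y|%:R :> F.
Proof.
have [_ Rdiag [_ Rdis] Rsym _] := RA.
have neq x y i : i != ord0 -> (x, y) \in R i -> x != y.
  move=> i0 xy; apply/negP => /eqP E.
  by have := disjointFr (Rdis _ _ i0) xy; rewrite Rdiag inE E /= eqxx.
have i20 : inord 2 != ord0 :> 'I_5 by rewrite -val_eqE /= inordK.
have i40 : inord 4 != ord0 :> 'I_5 by rewrite -val_eqE /= inordK.
have i24 : inord 2 != inord 4 :> 'I_5 by rewrite -val_eqE /= !inordK.
have [[x y] /= xy /andP[xY yY]] : exists2 xy, xy \in R (inord 2) &
  (xy.1 \in Y) && (xy.2 \in Y) by apply: clique_pair; rewrite !inE eqxx orbT.
have [[u v] /= uv /andP[uY vY]] : exists2 xy, xy \in R (inord 4) &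
  (xy.1 \in Y) && (xy.2 \in Y) by apply: clique_pair; rewrite !inE eqxx orbT.
have nxy := neq _ _ _ i20 xy; have nuv := neq _ _ _ i40 uv.
have [w wY nw] : exists2 w, w \in Y & w \notin [set x; y].
  have [ui|] := boolP (u \in [set x; y]); last by exists u.
  exists v => //; apply/negP => vi; have nR4 := disjointFr (Rdis _ _ i24).
  move: ui vi; rewrite !inE => /orP[] /eqP Eu /orP[] /eqP Ev; move: uv nuv;
    rewrite Eu Ev ?eqxx // => uv _.
  - by rewrite (nR4 _ xy) in uv.
  - by rewrite (nR4 _ (Rsym _ _ _ xy)) in uv.
have sub : w |: [set x; y] \subset Y.
  by apply/subsetP => z; rewrite !inE => /orP[|/orP[]] /eqP ->.
by have := subset_leq_card sub; rewrite cardsU1 nw cards2 nxy ltr_nat.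
Qed.

(* The quadratic form of M at the characteristic vector of Y. *)
Let qf (M : 'M[F]_n) := \sum_(a | s a \in Y) \sum_(b | s b \in Y) M a b.

Let card_ord : \sum_(a | s a \in Y) 1 = #|Y|%:R :> F.
Proof.
by rewrite -sum1_card natr_sum (reindex s) //; apply: onW_bij.
Qed.

Let qf_sum (q : 'I_5 -> F) :
  qf (\sum_i q i *: adjmx F s (R i)) = \sum_i q i * qf (adjmx F s (R i)).
Proof.
rewrite /qf; under eq_bigr => a _ do under eq_bigr => b _ do rewrite summxE.
under eq_bigr => a _ do rewrite exchange_big /=.
rewrite exchange_big /=; apply: eq_bigr => i _.
rewrite mulr_sumr; apply: eq_bigr => a _; rewrite mulr_sumr.
by apply: eq_bigr => b _; rewrite mxE.
Qed.

Let qf_absent i : i \notin [set inord 0; inord 2; inord 4] ->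
  qf (adjmx F s (R i)) = 0.
Proof.
move=> iI; rewrite /qf big1 // => a aY; rewrite big1 // => b bY; rewrite mxE.
case: (boolP (_ \in _)) => // abi; by rewrite (clique_rel aY bY abi) in iI.
Qed.

Let qfA0 : qf (A 0) = #|Y|%:R.
Proof.
rewrite inord0 (adjmx0 F s_bij RA) -card_ord; apply: eq_bigr => a aY.
rewrite (bigD1 a) //= big1 ?addr0 => [|b /andP[_ ba]]; rewrite mxE ?eqxx //.
by rewrite eq_sym (negPf ba).
Qed.

Let qfA1 : qf (A 1) = 0.
Proof. by apply: qf_absent; rewrite !inE -!val_eqE /= !inordK. Qed.

Let qfA3 : qf (A 3) = 0.
Proof. by apply: qf_absent; rewrite !inE -!val_eqE /= !inordK. Qed.

Let qfA2 : qf (A 2) = #|Y|%:R ^+ 2 - #|Y|%:R - qf (A 4).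
Proof.
have : qf (const_mx 1) = \sum_i 1 * qf (adjmx F s (R i)).
  rewrite -qf_sum -(sum_adjmx F s RA); congr qf; apply: eq_bigr => i _.
  by rewrite scale1r.
rewrite sum_ord5 qfA0 qfA1 qfA3.
have -> : qf (const_mx 1) = #|Y|%:R ^+ 2; last by move=> ->; ring.
rewrite /qf expr2 -{1}card_ord mulr_suml; apply: eq_bigr => a _.
by rewrite mul1r -card_ord; apply: eq_bigr => b _; rewrite mxE.
Qed.

Let deficit : #|Y|%:R - qf (A 4) =
  \sum_(a | s a \in Y) \sum_(b | s b \notin Y) A 4 a b.
Proof.
rewrite -card_ord /qf -sumrB; apply: eq_bigr => a _.
by rewrite -(A4_row a) (bigID (fun b => s b \in Y)) /= addrC addrK.
Qed.

Let qfe : qf e = \sum_b (\sum_(a | s a \in Y) e b a) ^+ 2.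
Proof.
rewrite /qf -{1}ee.
under eq_bigr => a _ do under eq_bigr => b _ do rewrite mxE.
under eq_bigr => a _ do rewrite exchange_big /=.
rewrite exchange_big /=; apply: eq_bigr => c _.
rewrite expr2 mulr_suml; apply: eq_bigr => a _; rewrite mulr_sumr.
by apply: eq_bigr => b _; rewrite (e_sym a c).
Qed.

(* Equality in the clique bound, from qf e >= 0 and qf (A 4) <= |Y|. *)
Let clique_bound_attained : qf e = 0 /\ qf (A 4) = #|Y|%:R.
Proof.
have [_ Rdiag [Rcov Rdis] Rsym _] := RA.
have /span_imageP[q eq] := eR.
have eqE a b i : (s a, s b) \in R i -> e a b = q i.
  by move=> abi; rewrite {1}eq (combination_entry _ Rdis abi).
have eaa a : e a a = q (inord 0) by apply: eqE; rewrite inord0 Rdiag inE.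
have [a0 qb] : exists a, exists b, e a b != 0.
  by apply/matrix0Pn.
have q0_gt0 : 0 < q (inord 0).
  case: qb => b ab; rewrite -(eaa a0) -ee mxE (bigD1 b) //= (e_sym b).
  rewrite -expr2 ltr_pwDl //; first by rewrite exprn_even_gt0.
  by apply: sumr_ge0 => c _; rewrite (e_sym c) -expr2 sqr_ge0.
(* Antipodal rows of e agree. *)
have q4 : q (inord 4) = q (inord 0).
  rewrite -(eaa a0) -A4e mxE -[LHS]mul1r -(A4_row a0) mulr_suml.
  apply: eq_bigr => b _; rewrite mxE.
  have [a0b|] := boolP (_ \in _); last by rewrite !mul0r.
  by rewrite (eqE _ _ _ (Rsym _ _ _ a0b)).
(* Compare diagonal entries in A 2 *m e = theta *: e. *)
have q2 : k * q (inord 2) = theta * q (inord 0).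
  have : (A 2 *m e) a0 a0 = theta * e a0 a0 by rewrite A2e mxE.
  rewrite eaa => <-; rewrite mxE -(A2k a0) mulr_suml.
  apply: eq_bigr => b _; rewrite mxE.
  have [a0b|] := boolP (_ \in _); last by rewrite !mul0r.
  by rewrite (eqE _ _ _ (Rsym _ _ _ a0b)).
have qfeE : qf e = q (inord 0) * #|Y|%:R +
    q (inord 2) * (#|Y|%:R ^+ 2 - #|Y|%:R - qf (A 4)) +
    q (inord 0) * qf (A 4).
  rewrite -qfA2 -{1}qfA0 -q4 eq qf_sum sum_ord5 q4.
  by rewrite qfA1 qfA3; ring.
have qfe_ge0 : 0 <= qf e by rewrite qfe sumr_ge0 // => b _; apply: sqr_ge0.
have a_le : qf (A 4) <= #|Y|%:R.
  rewrite -subr_ge0 deficit; apply: sumr_ge0 => a _; apply: sumr_ge0 => b _.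
  by rewrite mxE ler0n.
have y2 := clique_size_gt2.
have th0 : theta != 0.
  by apply: contraTneq y2 => th; rewrite Ysize th invr0 mulr0 subr0 mulr1 ltxx.
have thy : theta * (#|Y|%:R - 2) = - (2 * k) by rewrite Ysize; field.
move: (qf e) (qf (A 4)) (#|Y|%:R : F) (q (inord 0)) (q (inord 2)) q0_gt0 q2
  qfeE qfe_ge0 a_le y2 thy => S a y u v u0 vE SE S0 ay y2 thy.
have vy : (y - 2) * v = - 2 * u.
  apply: (mulfI (lt0r_neq0 k0)).
  have -> : k * ((y - 2) * v) = (y - 2) * (k * v) by ring.
  by rewrite vE mulrCA mulrA thy; ring.
have Sy : (y - 2) * S = u * y * (a - y).
  have -> : (y - 2) * S = (y - 2) * u * (y + a) + (y - 2) * v * (y ^+ 2 - y - a).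
    by rewrite SE; ring.
  by rewrite vy; ring.
have ya : a = y.
  apply/eqP; rewrite eq_le ay /=.
  have : 0 <= u * y * (a - y) by rewrite -Sy mulr_ge0 //; lra.
  by rewrite pmulr_rge0 ?subr_ge0 // mulr_gt0 //; lra.
split=> //; apply: (mulfI (x := y - 2)); first by apply: lt0r_neq0; lra.
by rewrite Sy ya subrr !mulr0.
Qed.

(** The count of pairs of Y in R_4 equals |Y|, so no antipode is missing. *)
Lemma clique_antipode x y : x \in Y -> (x, y) \in R (inord 4) -> y \in Y.
Proof.
have [_ qf4] := clique_bound_attained; have [s' s'K ss'] := s_bij.
rewrite -(ss' x) -(ss' y); move: (s' x) (s' y) => a b aY ab.
apply: contraT => bY; move/eqP: deficit; rewrite qf4 subrr eq_sym.
rewrite psumr_eq0 => [/allP/(_ a)|c _]; last first.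
  by apply: sumr_ge0 => d _; rewrite mxE ler0n.
rewrite mem_index_enum aY => /(_ isT) /=.
rewrite psumr_eq0 => [/allP/(_ b)|c _]; last by rewrite mxE ler0n.
by rewrite mem_index_enum bY mxE ab => /(_ isT) /=; rewrite oner_eq0.
Qed.

(** The quadratic form of e at the characteristic vector of Y is the squared norm
    of the image of that vector, and it vanishes. *)
Lemma clique_idempotent a : \sum_(b | s b \in Y) e a b = 0.
Proof.
have [+ _] := clique_bound_attained; rewrite qfe => /eqP.
rewrite psumr_eq0 => [/allP/(_ a)|c _]; last exact: sqr_ge0.
by rewrite mem_index_enum sqrf_eq0 => /(_ isT) /eqP.
Qed.

End Delsarte.

(** * Idempotents lifted from the quotient *)

Section CoverIdempotents.
Variables (F : realType) (X : finType) (R : 'I_5 -> {set X * X}).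
Variables (m : nat) (t : 'I_m -> quotient R) (s : 'I_(m * 2) -> X).
Variables (Ebar : 'I_3 -> 'M[F]_m) (E : 'I_5 -> 'M[F]_(m * 2)) (P : 'M[F]_5).
Hypothesis RA : association_scheme R.
Hypothesis R4 : has_valency F s (R (inord 4)) 1.
Hypothesis R2 : two_fold_cover R.
Hypothesis st : cover_ordering t s.
Hypothesis EbarP : primitive_idempotents t (quotient_rel R) Ebar.
Hypothesis EP : primitive_idempotents s R E.
Hypothesis EEbar : forall i : 'I_3, E (inord i) = 2^-1 *: (Ebar i *t J2 F).
Hypothesis AP : first_eigenmatrix s R E P.
Local Notation A i := (adjmx F s (R (inord i))).

Let s_bij : bijective s. Proof. by case: st. Qed.

Lemma fibre_position a b : fibre_rel R (s a) (s b) ->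
  (mxtens_unindex a).1 = (mxtens_unindex b).1.
Proof.
have [t_bij _ st_mem] := st; have [Req _] := R2 => ab.
apply: (bij_inj t_bij); apply: val_inj; apply/setP => x.
have mem c : (x \in val (t (mxtens_unindex c).1)) = fibre_rel R (s c) x.
  have := st_mem c; case: (t _) => C /=; rewrite /fibres => /imsetP[z _ ->].
  by rewrite !inE => zc; have [_ <-] := Req z (s c) x.
by rewrite !mem; have [_ ->] := Req (s a) (s b) x.
Qed.

(** A matrix lifted from the quotient has equal rows at antipodal points. *)
Lemma antipodal_idempotent (i : 'I_3) : A 4 *m E (inord i) = E (inord i).
Proof.
apply: mul_adjmx_valency1 => // a c b ac.
by rewrite EEbar !mxE (@fibre_position a c) // /fibre_rel inE ac orbT.
Qed.

(** The lift of an element of the Bose-Mesner algebra of the quotient involves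
    only E_0, E_1, E_2. *)
Lemma block_combination (i : 'I_3) : exists c : 'I_3 -> F,
  \sum_(k in index_block i) adjmx F s (R k) = \sum_l c l *: E (inord l).
Proof.
have [_ _ /andP[/eqP Espan _]] := EbarP.
have : adjmx F t (quotient_rel R i) \in bose_mesner F t (quotient_rel R).
  by apply/memv_span/map_f/mem_enum.
rewrite -Espan => /span_imageP[c cE]; exists (fun l => 2 * c l).
rewrite (quotient_adjmx _ RA R2 st) cE; apply/matrixP => a b.
rewrite mxE !summxE mulr_suml; apply: eq_bigr => l _.
by rewrite EEbar !mxE; field.
Qed.

Lemma adjmx_idempotent i l : adjmx F s (R i) *m E l = P l i *: E l.
Proof.
rewrite AP mulmx_suml (bigD1 l) //= big1 ?addr0 => [|j jl];
  rewrite -scalemxAl (primitive_idempotents_orthogonal s_bij RA _ _ EP).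
  by rewrite eqxx.
by rewrite (negPf jl) scaler0.
Qed.

(** By orthogonality, the coefficients in [block_combination] are the eigenvalues
    on E_0, E_1, E_2. *)
Lemma block_expansion (i : 'I_3) (c : 'I_3 -> F) :
  (forall l : 'I_3, (\sum_(k in index_block i) adjmx F s (R k)) *m E (inord l) =
     c l *: E (inord l)) ->
  \sum_(k in index_block i) adjmx F s (R k) = \sum_l c l *: E (inord l).
Proof.
have [c' c'E] := block_combination i; rewrite c'E => cE.
apply: eq_bigr => l _; rewrite -cE mulmx_suml (bigD1 l) //= big1 => [|j jl];
  rewrite -scalemxAl (primitive_idempotents_orthogonal s_bij RA _ _ EP).
  by rewrite eqxx addr0.
have jl' : (inord j == inord l :> 'I_5) = false.
  apply: contraNF jl => /eqP/(congr1 val) /=.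
  rewrite !inordK ?(ltn_trans (ltn_ord _)) //.
  by move/val_inj ->.
by rewrite jl' scaler0.
Qed.

Lemma fibre_matrix_expansion :
  A 0 + A 4 = 2 *: (E (inord 0) + E (inord 1) + E (inord 2)).
Proof.
have -> : A 0 + A 4 = \sum_(k in index_block ord0) adjmx F s (R k).
  rewrite /index_block /= big_setU1 ?big_set1 //.
  by rewrite inE -val_eqE /= !inordK.
rewrite (block_expansion (c := fun=> 2)) => [|l].
  by rewrite -scaler_sumr !big_ord_recl big_ord0 addr0 addrA.
rewrite /index_block /= big_setU1 ?big_set1; last first.
  by rewrite inE -val_eqE /= !inordK.
rewrite mulmxDl antipodal_idempotent inord0 (adjmx0 F s_bij RA) mul1mx.
by rewrite -[in LHS]mulr2n -scaler_nat.
Qed.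

Lemma A2_expansion : A 2 =
  P (inord 0) (inord 2) *: E (inord 0) + P (inord 1) (inord 2) *: E (inord 1) +
  P (inord 2) (inord 2) *: E (inord 2).
Proof.
have -> : A 2 = \sum_(k in index_block ord_max) adjmx F s (R k).
  by rewrite /index_block /= big_set1.
rewrite (block_expansion (c := fun l => P (inord l) (inord 2))) => [|l].
  by rewrite !big_ord_recl big_ord0 addr0 addrA.
by rewrite /index_block /= big_set1 adjmx_idempotent.
Qed.

(** E_0 is a nonzero multiple of the all-ones matrix, so its eigenvalue is the row
    sum. *)
Lemma A2_valency a : \sum_b A 2 a b = P (inord 0) (inord 2).
Proof.
have [E0 Eprim _] := EP; have [_ E00 _ _] := Eprim ord0.
have n0 : (m * 2)%:R^-1 != 0 :> F.
  by apply: contraNneq E00 => z; rewrite E0 z scale0r.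
have /matrixP/(_ a a) := adjmx_idempotent (inord 2) (inord 0).
rewrite inord0 E0 -scalemxAr !mxE mulrCA => /(mulfI n0); rewrite mulr1 => <-.
by apply: eq_bigr => b _; rewrite !mxE mulr1.
Qed.

Lemma A2_valency_gt0 : 0 < P (inord 0) (inord 2).
Proof.
have [R0 _ _ _ _] := RA; have /set0Pn[[x y] xy] := R0 (inord 2).
have [s' s'K ss'] := s_bij.
rewrite -(A2_valency (s' x)) (bigD1 (s' y)) //= ltr_pwDl //.
  by rewrite mxE !ss' xy.
by apply: sumr_ge0 => b _; rewrite mxE ler0n.
Qed.

End CoverIdempotents.

(** * The refined relations *)

Section Refinement.
Variables (F : realType) (X : finType) (n : nat) (s : 'I_n -> X).
Variables (R : 'I_5 -> {set X * X}) (f : nat) (Y : 'I_f -> {set X}).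
Hypothesis s_bij : bijective s.
Hypothesis RA : association_scheme R.
Local Notation A i := (adjmx F s (R (inord i))).
Let U := \bigcup_j setX (Y j) (Y j).
Let B := adjmx F s U.

Definition coarse_index (i : 'I_6) : 'I_5 :=
  inord (if val i == 5 then 2 else val i).

Lemma in_refined_rel i xy : (xy \in refined_rel R Y i) =
  (xy \in R (coarse_index i)) &&
  (match val i with 2 => xy \in U | 5 => xy \notin U | _ => true end).
Proof.
rewrite /refined_rel /coarse_index -/U.
case: i => [[|[|[|[|[|[|//]]]]]] ?] /=; rewrite ?andbT ?inE //.
by rewrite negb_and andb_orl andNb /= andbC.
Qed.

Lemma refined_disjoint i j :
  i != j -> [disjoint refined_rel R Y i & refined_rel R Y j].
Proof.
have [_ _ [_ Rdis] _ _] := RA.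
move=> ij; apply/pred0P => xy /=; apply/negP; rewrite !in_refined_rel.
case/andP => /andP[xyi iU] /andP[xyj jU].
have pij : coarse_index i = coarse_index j.
  by apply/eqP/negPn/negP => /Rdis /disjointFr /(_ xyi); rewrite xyj.
move/(congr1 val): pij; move: iU jU ij; rewrite /coarse_index {xyi xyj}.
case: i => [[|[|[|[|[|[|//]]]]]] ?]; case: j => [[|[|[|[|[|[|//]]]]]] ?] //=;
  rewrite ?inordK // => iU jU ij; first [by rewrite iU in jU | by rewrite jU in iU].
Qed.

Lemma refined_cover : \bigcup_i refined_rel R Y i = setT.
Proof.
have [_ _ [Rcov _] _ _] := RA; apply/setP => xy; rewrite [RHS]inE.
have : xy \in \bigcup_i R i by rewrite Rcov inE.
case/bigcupP => i _ xyi; apply/bigcupP.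
have in_inord k : (k < 6)%N -> (xy \in refined_rel R Y (inord k)) =
    (xy \in R (inord (if k == 5 then 2 else k))) &&
    (match k with 2 => xy \in U | 5 => xy \notin U | _ => true end).
  by move=> k6; rewrite in_refined_rel /coarse_index /= inordK.
move: i xyi; apply: ord5P => xyi.
- by exists (inord 0); rewrite // in_inord //= xyi.
- by exists (inord 1); rewrite // in_inord //= xyi.
- have [xyU|nU] := boolP (xy \in U).
    by exists (inord 2); rewrite // in_inord //= xyi.
  by exists (inord 5); rewrite // in_inord //= xyi.
- by exists (inord 3); rewrite // in_inord //= xyi.
- by exists (inord 4); rewrite // in_inord //= xyi.
Qed.

Lemma spread_rel_sym x y : (x, y) \in U -> (y, x) \in U.
Proof.
case/bigcupP => j _; rewrite !inE /= => /andP[xY yY].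
by apply/bigcupP; exists j; rewrite ?inE /= ?xY ?yY.
Qed.

Lemma refined_sym i x y :
  (x, y) \in refined_rel R Y i -> (y, x) \in refined_rel R Y i.
Proof.
have [_ _ _ Rsym _] := RA; rewrite !in_refined_rel => /andP[/Rsym -> /=].
have Uxy : ((x, y) \in U) = ((y, x) \in U) by apply/idP/idP; apply: spread_rel_sym.
by rewrite Uxy.
Qed.

Hypothesis RU : R (inord 0) :|: R (inord 4) \subset U.
Hypothesis UR : U \subset R (inord 0) :|: R (inord 2) :|: R (inord 4).

Let W := (bose_mesner F s R + <[B]>)%VS.

Let bose_mesner_sub_W : (bose_mesner F s R <= W)%VS.
Proof. exact: addvSl. Qed.

Let B_in_W : B \in W.
Proof. by apply: (subvP (addvSr _ _)); apply: memv_line. Qed.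

Let B_sym : B^T = B.
Proof.
apply/matrixP => a b; rewrite !mxE; congr (_%:R); congr (nat_of_bool _).
by apply/idP/idP; apply: spread_rel_sym.
Qed.

Lemma refined_in_U i xy : xy \in refined_rel R Y i ->
  (xy \in U) = (val i \in [:: 0; 2; 4]).
Proof.
have [_ _ [_ Rdis] _ _] := RA; rewrite in_refined_rel => /andP[].
have RU0 k : (k == 0) || (k == 4) -> xy \in R (inord k) -> xy \in U.
  move=> k04 xyk; apply: (subsetP RU); rewrite inE.
  by move: k04 xyk => /orP[] /eqP -> ->; rewrite ?orbT.
have UR1 k : (k == 1) || (k == 3) -> xy \in R (inord k) -> (xy \in U) = false.
  move=> k13 xyk; apply/negP => /(subsetP UR); rewrite !inE.
  have nR l : inord k != inord l :> 'I_5 -> xy \in R (inord l) = false.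
    by move=> kl; apply: disjointFr (Rdis _ _ kl) xyk.
  by case/orP: k13 nR => /eqP -> nR; rewrite !nR // -val_eqE /= !inordK.
rewrite /coarse_index; case: i => [[|[|[|[|[|[|//]]]]]] ?] //= xyi.
- by rewrite (RU0 0).
- by rewrite (UR1 1).
- by rewrite (UR1 3).
- by rewrite (RU0 4).
- by move/negPf.
Qed.

(** On the refined relations B is the indicator of the indices 0, 2, 4, so
    subtracting from a matrix constant on them the multiple of B by the
    difference of its values on the two parts of R_2 leaves a matrix constant on
    R_2. *)
Lemma refined_bose_mesner : bose_mesner F s (refined_rel R Y) = W.
Proof.
have [_ _ [Rcov Rdis] _ _] := RA.
apply/eqP; rewrite eqEsubv; apply/andP; split; apply/subvP => e.
  case/(bose_mesnerP _ _ refined_cover refined_disjoint) => q qe.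
  pose c := q (inord 2) - q (inord 5).
  rewrite -(subrK (c *: B) e); apply: memv_add; last exact/memvZ/memv_line.
  apply/(bose_mesnerP _ _ Rcov Rdis).
  exists (fun k : 'I_5 => if val k == 2 then q (inord 5) else
    q (inord k) - c * (val k \in [:: 0; 4])%:R) => a b k abk.
  have : (s a, s b) \in \bigcup_i refined_rel R Y i by rewrite refined_cover inE.
  case/bigcupP => i _ abi.
  have -> : k = coarse_index i.
    apply/eqP/negPn/negP => /Rdis /disjointFr /(_ abk).
    by move: abi; rewrite in_refined_rel => /andP[->].
  rewrite !mxE (refined_in_U abi) (qe _ _ _ abi) -{1}(inord_val i) /coarse_index.
  by case: i {abi} => [[|[|[|[|[|[|//]]]]]] ?] /=; rewrite !inordK //= /c; ring.
case/memv_addP => e' eR [_ /vlineP[c ->] ->].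
have /(bose_mesnerP _ _ Rcov Rdis)[q qe] := eR.
apply/(bose_mesnerP _ _ refined_cover refined_disjoint).
exists (fun i => q (coarse_index i) + c * (val i \in [:: 0; 2; 4])%:R) => a b i abi.
rewrite !mxE (refined_in_U abi); congr (_ + _); apply: qe.
by move: abi; rewrite in_refined_rel => /andP[].
Qed.

Hypothesis AB : forall i, adjmx F s (R i) *m B \in W.
Hypothesis BB : B *m B \in W.

Let W_sym e : e \in W -> e^T = e.
Proof.
case/memv_addP => e' eR [_ /vlineP[c ->] ->].
by rewrite linearD linearZ /= B_sym (bose_mesner_sym RA eR).
Qed.

Let mulB e : e \in bose_mesner F s R -> e *m B \in W.
Proof.
case/span_imageP => q ->; rewrite mulmx_suml; apply: memv_suml => i _.
by rewrite -scalemxAl; apply: memvZ.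
Qed.

Let W_mul e e' : e \in W -> e' \in W -> e *m e' \in W.
Proof.
case/memv_addP => u uR [_ /vlineP[c ->] ->].
case/memv_addP => v vR [_ /vlineP[d ->] ->].
rewrite mulmxDl !mulmxDr -!scalemxAl -!scalemxAr.
have Bv : B *m v = v *m B.
  by rewrite -[RHS](W_sym (mulB vR)) trmx_mul B_sym (bose_mesner_sym RA vR).
have uvW : u *m v \in W.
  by apply: (subvP bose_mesner_sub_W); apply: bose_mesner_mul.
by rewrite Bv; apply: memvD; apply: memvD => //; do ?[apply: memvZ => //];
  apply: mulB.
Qed.

(** Products v B suffice: they are symmetric, so they also give the products
    B v, and W is closed under multiplication. *)
Lemma refined_association_scheme :
  refined_rel R Y (inord 2) != set0 -> refined_rel R Y (inord 5) != set0 ->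
  association_scheme (refined_rel R Y).
Proof.
have [Rn0 Rdiag _ _ _] := RA => R2 R5; split.
- move=> i; rewrite -(inord_val i).
  case: i => [[|[|[|[|[|[|//]]]]]] ?] //=; rewrite /refined_rel /= inordK //.
- by rewrite /refined_rel /= inord0.
- by split; [exact: refined_cover | exact: refined_disjoint].
- exact: refined_sym.
- move=> i j k; apply: (intersection_numbers_of_mul (F := F) s_bij).
    exact: refined_disjoint.
  by rewrite refined_bose_mesner W_mul // -refined_bose_mesner bose_mesner_adjmx.
Qed.

End Refinement.

(** * Partitions into cliques *)

Section Spreads.
Variables (F : realType) (X : finType) (n : nat) (s : 'I_n -> X).
Variables (f : nat) (Y : 'I_f -> {set X}).
Hypothesis s_bij : bijective s.
Hypothesis Ycov : \bigcup_i Y i = [set: X].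
Hypothesis Ydis : forall i j, i != j -> [disjoint Y i & Y j].
Let U := \bigcup_j setX (Y j) (Y j).
Let B := adjmx F s U.

Lemma spread_mem j x y : y \in Y j -> ((x, y) \in U) = (x \in Y j).
Proof.
move=> yY; apply/bigcupP/idP => [[i _]|xY]; last by exists j; rewrite ?inE //= xY.
rewrite !inE /= => /andP[xY yi]; have [<- //|ij] := eqVneq i j.
by rewrite (disjointFr (Ydis ij) yi) in yY.
Qed.

Lemma spread_cover x : exists j, x \in Y j.
Proof.
have : x \in \bigcup_j Y j by rewrite Ycov inE.
by case/bigcupP => j _; exists j.
Qed.

Lemma mulmx_spread (M : 'M[F]_n) a b j : s b \in Y j ->
  (M *m B) a b = \sum_(c | s c \in Y j) M a c.
Proof.
move=> bY; rewrite mxE [RHS]big_mkcond /=; apply: eq_bigr => c _.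
by rewrite mxE (spread_mem _ bY); case: ifP; rewrite ?mulr1 ?mulr0.
Qed.

Variable y : F.
Hypothesis Ysize : forall i, #|Y i|%:R = y.

Let size_ord j : \sum_(c | s c \in Y j) 1 = y :> F.
Proof.
by rewrite -(Ysize j) -sum1_card natr_sum (reindex s) //; apply: onW_bij.
Qed.

Lemma const_mul_spread c :
  (const_mx c : 'M_n) *m B = const_mx (c * y).
Proof.
apply/matrixP => a b; have [j bY] := spread_cover (s b).
rewrite (mulmx_spread _ _ bY) mxE -(size_ord j) mulr_sumr.
by apply: eq_bigr => d _; rewrite mxE mulr1.
Qed.

Lemma spread_mul_spread : B *m B = y *: B.
Proof.
apply/matrixP => a b; have [j bY] := spread_cover (s b).
rewrite (mulmx_spread _ _ bY) !mxE (spread_mem _ bY) -(size_ord j) mulr_suml.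
apply: eq_bigr => d dY; by rewrite mxE (spread_mem _ dY) mul1r.
Qed.

End Spreads.

(** * The refined scheme *)

Theorem theorem3p2 (F : realType) (X : finType) (R : 'I_5 -> {set X * X})
    (m : nat) (t : 'I_m -> quotient R) (s : 'I_(m * 2) -> X)
    (Ebar : 'I_3 -> 'M[F]_m) (E : 'I_5 -> 'M[F]_(m * 2)) (P : 'M[F]_5)
    (theta : F) (f : nat) (Y : 'I_f -> {set X}) :
  association_scheme R ->
  has_valency F s (R (inord 4)) 1 ->
  two_fold_cover R ->
  cover_ordering t s ->
  primitive_idempotents t (quotient_rel R) Ebar ->
  primitive_idempotents s R E ->
  (forall i : 'I_3, E (inord i) = 2^-1 *: (Ebar i *t J2 F)) ->
  first_eigenmatrix s R E P ->
  theta = Num.min (P (inord 1) (inord 2)) (P (inord 2) (inord 2)) ->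
  (forall i, is_clique R [set inord 0; inord 2; inord 4] (Y i)) ->
  (forall i, #|Y i|%:R = 2 * (1 - P (inord 0) (inord 2) / theta)) ->
  \bigcup_i Y i = [set: X] ->
  (forall i j, i != j -> [disjoint Y i & Y j]) ->
  refined_rel R Y (inord 5) != set0 ->
  association_scheme (refined_rel R Y).
Proof.
move=> RA R4 R2 st EbarP EP EEbar AP thetaE YC Ysize Ycov Ydis R5.
have s_bij : bijective s by case: st.
have [Rn0 Rdiag [Rcov Rdis] Rsym _] := RA.
pose A i := adjmx F s (R (inord i)).
set y := 2 * _ in Ysize.
pose U := \bigcup_j setX (Y j) (Y j); pose B := adjmx F s U.
have [j [thetaj j12]] : exists j : 'I_3, theta = P (inord j) (inord 2) /\
    (j = inord 1 \/ j = inord 2).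
  rewrite thetaE; case: ltP => _; [exists (inord 1) | exists (inord 2)];
    by rewrite inordK //; auto.
have [clique_closed EjB] :
  (forall i u v, u \in Y i -> (u, v) \in R (inord 4) -> v \in Y i) /\
  E (inord j) *m B = 0.
  have [_ Eprim _] := EP; have [EjR Ej0 Ejj _] := Eprim (inord j).
  have A4E := antipodal_idempotent R4 R2 st EEbar j.
  have A2E := adjmx_idempotent RA st EP AP (inord 2) (inord j).
  rewrite -thetaj in A2E.
  have k0 := A2_valency_gt0 RA st EP AP; have A2k := A2_valency RA st EP AP.
  split=> // [i u v|].
    by apply: (clique_antipode s_bij RA R4 EjR Ej0 Ejj A4E A2E k0 A2k (YC i)).
  apply/matrixP => a b; have [i bY] := spread_cover Ycov (s b).
  rewrite (mulmx_spread Ydis _ _ bY) [RHS]mxE.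
  exact: (clique_idempotent s_bij RA R4 EjR Ej0 Ejj A4E A2E k0 A2k (YC i)).
have A4B : A 4 *m B = B.
  apply: mul_adjmx_valency1 => // a c b ac; have [i bY] := spread_cover Ycov (s b).
  rewrite !mxE !(spread_mem Ydis _ bY); congr (_%:R); congr (nat_of_bool _).
  by apply/idP/idP => H; apply: clique_closed H _ => //; apply: Rsym.
have BB : B *m B = y *: B by apply: spread_mul_spread.
have JB c : (const_mx c : 'M_(m * 2)) *m B = const_mx (c * y).
  exact: const_mul_spread.
have A0 : A 0 = 1%:M by rewrite /A inord0 adjmx0.
have A31 : A 1 *m B = A 3 *m B.
  have A41 : A 4 *m A 1 = A 3.
    apply: mul_adjmx_valency1 => // a c b ac; rewrite !mxE.
    congr (_%:R); congr (nat_of_bool _); apply/idP/idP.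
      by apply: (antipode_swap s_bij RA R4 R2 _ _ ac); rewrite -?val_eqE /= ?inordK.
    apply: (antipode_swap s_bij RA R4 R2 _ _ (Rsym _ _ _ ac)).
      by rewrite setUC.
    by rewrite -val_eqE /= !inordK.
  rewrite -{1}A4B mulmxA -A41.
  by congr (_ *m _); apply: (bose_mesner_comm s_bij RA); apply: bose_mesner_adjmx.
have A2B : exists al be, A 2 *m B = const_mx al + be *: B.
  have E0B : exists al, E (inord 0) *m B = const_mx al.
    have [E0 _ _] := EP; rewrite inord0 E0 -scalemxAl JB.
    by exists ((m * 2)%:R^-1 * (1 * y)); apply/matrixP => a b; rewrite !mxE.
  have [al E0al] := E0B.
  (* As E_j B = 0, this determines the last eigencomponent of B from B and J. *)
  have EB : 2 *: (E (inord 0) *m B + E (inord 1) *m B + E (inord 2) *m B) = 2 *: B.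
    rewrite -!mulmxDl scalemxAl -(fibre_matrix_expansion RA R4 R2 st EbarP EP EEbar).
    by rewrite mulmxDl -/(A 0) -/(A 4) A4B A0 mul1mx -mulr2n scaler_nat.
  have {}EB : E (inord 0) *m B + E (inord 1) *m B + E (inord 2) *m B = B.
    by apply: (scalerI _ EB); rewrite pnatr_eq0.
  rewrite /A (A2_expansion RA R2 st EbarP EP EEbar AP) !mulmxDl -!scalemxAl.
  move: EjB EB; rewrite E0al; case: j12 => ->; rewrite inordK // => -> EB;
    rewrite scaler0 ?addr0; [set be := P (inord 2) _ | set be := P (inord 1) _];
    exists ((P (inord 0) (inord 2) - be) * al), be; rewrite -[in RHS]EB;
    by apply/matrixP => a b; rewrite !mxE; ring.
have [al [be A2BE]] := A2B.
pose W := (bose_mesner F s R + <[B]>)%VS.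
have BW : B \in W by apply: (subvP (addvSr _ _)); apply: memv_line.
have JW c : const_mx c \in W.
  by apply: (subvP (addvSl _ _)); apply: bose_mesner_const.
have A2W : A 2 *m B \in W by rewrite A2BE memvD // memvZ.
have A0B : A 0 *m B = B by rewrite A0 mul1mx.
have A1W : A 1 *m B \in W.
  have JE : const_mx 1 = A 0 + A 1 + A 2 + A 3 + A 4.
    by rewrite -(sum_adjmx F s RA) sum_ord5.
  have : 2 *: (A 1 *m B) = const_mx (1 * y) - 2 *: B - A 2 *m B.
    rewrite -JB JE !mulmxDl A4B A0B -A31; apply/matrixP => a b; rewrite !mxE; ring.
  move=> A1E; rewrite -[A 1 *m B](scalerK (a := 2)) ?pnatr_eq0 // A1E.
  by apply: memvZ; rewrite memvB ?memvB ?memvZ.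
have UE : R (inord 0) :|: R (inord 4) \subset U.
  apply/subsetP => -[u v]; have [i vY] := spread_cover Ycov v.
  rewrite inE (spread_mem Ydis _ vY) => /orP[|uv].
    by rewrite inord0 Rdiag inE /= => /eqP ->.
  by apply: clique_closed vY (Rsym _ _ _ uv).
have EU : U \subset R (inord 0) :|: R (inord 2) :|: R (inord 4).
  apply/subsetP => -[u v] /bigcupP[i _]; rewrite inE /= => /andP[uY vY].
  have : (u, v) \in \bigcup_k R k by rewrite Rcov inE.
  case/bigcupP => k _ uv; have := clique_rel (YC i) uY vY uv.
  by rewrite !inE => /orP[/orP[]|] /eqP kE; rewrite -kE uv ?orbT.
apply: (refined_association_scheme (F := F) s_bij RA UE EU) => //.
- apply: ord5P => //; rewrite -/(A _) -/U -/B -/W.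
  + by rewrite A0B.
  + by rewrite -A31.
  + by rewrite A4B.
- by rewrite -/U -/B BB memvZ.
have /set0Pn[[x _] _] := Rn0 ord0; have [i xY] := spread_cover Ycov x.
have /(clique_pair (YC i)) [[u v] uv /= /andP[uY vY]] :
  inord 2 \in ([set inord 0; inord 2; inord 4] : {set 'I_5}) by rewrite !inE eqxx orbT.
apply/set0Pn; exists (u, v); rewrite /refined_rel /= inordK // inE uv /=.
by rewrite -/U (spread_mem Ydis _ vY).
Qed.
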